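(* Let $\epsilon\in(0,1)$, $\delta\in(0,1)$, and let $\psi\in\Psi\subseteq[0,1]$ be a threshold with associated loss sequence $(z_t)_{t\in\mathcal{T}}$, $z_t=\ell(\hat f_\psi(x_t),y_t)\in[0,1]$, and filtration $(\mathcal{F}_t)_{t\ge 0}$. Let $(\lambda_t)_{t\in\mathcal{T}}$ be a predictable sequence of betting rates with $\lambda_t\in[0,1/\epsilon)$ for all $t\in\mathcal{T}$, and let $$M_0(\psi)=1,\qquad M_t(\psi)=\prod_{i=1}^{t}\bigl(1+\lambda_i(z_i-\epsilon)\bigr),\quad t\in\mathcal{T}.$$ Suppose that $\psi$ satisfies the null hypothesis, i.e. $$\mathbb{E}_{P_t}[z_t\mid\mathcal{F}_{t-1}]\le\epsilon\qquad\text{for all } t\in\mathcal{T}.$$ Then $$\mathbb{P}\bigl(\exists\, t\in\mathcal{T}:\ M_t(\psi)\ge 1/\delta\bigr)\le\delta.$$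
   Context: Setting: $\mathcal{T}=\{1,\dots,T\}$ is a time index set. At each time $t\in\mathcal{T}$ a random pair $(x_t,y_t)\in\mathcal{X}\times\mathcal{Y}$ is observed, drawn from a time-dependent distribution $P_t$; no assumption is made on how $P_t$ changes with $t$ or on the dependence between observations at different times. For a threshold $\psi\in\Psi\subseteq[0,1]$, $\hat f_\psi$ is a fixed predictor with a decision mechanism depending on $\psi$, and $\ell$ is a loss function with values in $[0,1]$; the loss at time $t$ is the random variable $z_t=\ell(\hat f_\psi(x_t),y_t)\in[0,1]$. Filtration: $\mathcal{F}_0$ is the trivial $\sigma$-field and $\mathcal{F}_t=\sigma(\{(z_1,\pi_1),\dots,(z_t,\pi_t)\})$, where $\pi_t$ is a forecaster's real-valued guess of the risk at time $t$, made from the history up to time $t-1$ (so $\pi_t$ is $\mathcal{F}_{t-1}$-measurable). $\mathbb{E}_{P_t}[z_t\mid\mathcal{F}_{t-1}]$ denotes the conditional expectation of $z_t$ given $\mathcal{F}_{t-1}$. Predictable: $(\lambda_t)$ is predictable if each $\lambda_t$ is $\mathcal{F}_{t-1}$-measurable. *)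

(* Defs.v *)
From HB Require Import structures.
From mathcomp Require Import all_boot all_order all_algebra.
From mathcomp Require Import all_classical all_reals all_analysis.

Set Implicit Arguments.
Unset Strict Implicit.
Unset Printing Implicit Defensive.

Import Order.TTheory GRing.Theory Num.Theory.
Import numFieldNormedType.Exports.

Local Open Scope classical_set_scope.
Local Open Scope ring_scope.

(* Random variables are indexed by all of nat, but only the values at the
   times 1, ..., T of the horizon are ever meaningful. *)
Definition horizon (T : nat) : set nat := [set t | (1 <= t <= T)%N].

Definition loss_process (Omega X Y D : Type) (R : realType)
    (loss : D -> Y -> R) (f : R -> X -> D) (psi : R)
    (x : nat -> Omega -> X) (y : nat -> Omega -> Y) (t : nat) (w : Omega) : R :=
  loss (f psi (x t w)) (y t w).

(* sigma((z_1, guess_1), ..., (z_t, guess_t)); ordinals start at 0, hence the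
   shift, and for t = 0 this is <<s set0 >>, the trivial sigma-algebra. *)
Definition history (Omega : Type) (R : realType) (z guess : nat -> Omega -> R)
    (t : nat) : set_system Omega :=
  g_sigma_preimage (fun (i : 'I_t) (w : Omega) => (z i.+1 w, guess i.+1 w)).

Definition measurable_wrt d (Omega : measurableType d) (R : realType)
    (G : set_system Omega) (h : Omega -> R) : Prop :=
  measurable_fun [set: g_sigma_algebraType G] h.

Definition predictable d (Omega : measurableType d) (R : realType) (T : nat)
    (F : nat -> set_system Omega) (h : nat -> Omega -> R) : Prop :=
  forall t, horizon T t -> measurable_wrt (F t.-1) (h t).

(* g is a version of the conditional expectation of Z given the
   sub-sigma-algebra G. *)
Definition is_cond_exp d (Omega : measurableType d) (R : realType)
    (P : probability Omega R) (G : set_system Omega) (Z g : Omega -> R) : Prop :=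
  [/\ measurable_wrt G g,
      P.-integrable setT (EFin \o g) &
      forall A, G A -> (\int[P]_(w in A) (g w)%:E = \int[P]_(w in A) (Z w)%:E)%E].

(* Conditional expectations being unique only up to null sets, the inequality
   E[z_t | F_{t-1}] <= eps is meant almost surely. *)
Definition null_hypothesis d (Omega : measurableType d) (R : realType)
    (P : probability Omega R) (T : nat) (F : nat -> set_system Omega)
    (z : nat -> Omega -> R) (eps : R) : Prop :=
  forall t, horizon T t ->
    exists2 g, is_cond_exp P (F t.-1) (z t) g & {ae P, forall w, g w <= eps}.

Definition wealth (Omega : Type) (R : realType) (eps : R)
    (z lambda : nat -> Omega -> R) (t : nat) (w : Omega) : R :=
  \prod_(1 <= i < t.+1) (1 + lambda i w * (z i w - eps)).

(* Main.v *)
(* Ville's inequality by stopping: replacing lambda_t by 0 once the wealth has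
   reached 1/delta gives another predictable bet, whose terminal wealth is the
   original wealth frozen at its first crossing. Any such wealth is a
   nonnegative supermartingale started at 1, because
   E[W (z_t - eps)] <= 0 for W = M_{t-1} lambda_t >= 0, which is
   F_{t-1}-measurable. So Markov's inequality at time T bounds the probability
   that the wealth ever crosses 1/delta. *)
Require Import Defs.
From mathcomp Require Import all_boot all_order all_algebra.
From mathcomp Require Import all_classical all_reals all_analysis.
From mathcomp Require Import measurable_realfun ring lra.

Import Order.TTheory GRing.Theory Num.Theory.

Local Open Scope classical_set_scope.
Local Open Scope ring_scope.

Import HBNNSimple.

Set Implicit Arguments.
Unset Strict Implicit.

(** * Measurability with respect to a generated sub-sigma-algebra *)

Lemma generated_sub_measurable d (Omega : measurableType d)
  (G : set_system Omega) :
  G `<=` measurable -> <<s G >> `<=` (measurable : set_system Omega).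
Proof. by apply: smallest_sub; exact: sigma_algebra_measurable. Qed.

Lemma measurable_wrtS d (Omega : measurableType d) (R : realType)
  (G H : set_system Omega) (h : Omega -> R) :
  G `<=` H -> measurable_wrt G h -> measurable_wrt H h.
Proof.
by move=> GH mh _ B mB; exact: (sub_sigma_algebra2 GH (mh measurableT B mB)).
Qed.

Lemma measurable_wrt_measurable d (Omega : measurableType d) (R : realType)
  (G : set_system Omega) (h : Omega -> R) :
  G `<=` measurable -> measurable_wrt G h -> measurable_fun setT h.
Proof.
move=> Gm mh _ B mB.
exact: (generated_sub_measurable Gm (mh measurableT B mB)).
Qed.

(** * Integral inequalities under nonnegative weights, and conditional expectation *)

(** Each level set of [W] lies in [<<s G>>]. Splitting along these finitely many sets turns both
    sides into sums of values of [W] times integrals over level sets, which [ab] compares term by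
    term. *)
Lemma le_integral_weighted_nnsfun d (Omega : measurableType d) (R : realType)
  (P : {measure set Omega -> \bar R}) (G : set_system Omega)
  (a b : Omega -> R) (W : {nnsfun (g_sigma_algebraType G) >-> R}) :
  G `<=` measurable ->
  measurable_fun setT a -> measurable_fun setT b ->
  (forall w, 0 <= a w) -> (forall w, 0 <= b w) ->
  (forall A, <<s G >> A ->
    (\int[P]_(w in A) (a w)%:E <= \int[P]_(w in A) (b w)%:E)%E) ->
  (\int[P]_w (W w * a w)%:E <= \int[P]_w (W w * b w)%:E)%E.
Proof.
move=> Gm ma mb a0 b0 ab.
pose A y : set Omega := W @^-1` [set y].
have GA y : <<s G >> (A y).
  exact: (measurable_funPTI W (measurable_set1 y)).
have mA y : measurable (A y) by exact: generated_sub_measurable (GA y).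
(* On the range of [W] the coefficient [|y|] is just [y]; the absolute value makes the summand
   nonnegative for every real [y], as exchanging sum and integral requires. *)
have decomp (h : Omega -> R) : measurable_fun setT h -> (forall w, 0 <= h w) ->
    (\int[P]_w (W w * h w)%:E =
     \sum_(y \in range W) (`|y|%:E * \int[P]_(w in A y) (h w)%:E))%E.
  move=> mh h0.
  pose hA y : Omega -> \bar R := (EFin \o h) \_ (A y).
  transitivity (\int[P]_w
      \sum_(y \in range W) (`|y|%:E * hA y w))%E.
    apply: eq_integral => w _.
    rewrite (fsbigD1 (W w))//=; last by exists w.
    rewrite fsbig1 ?adde0 => [|y [_ /= /nesym yW]].
      by rewrite /hA patchE mem_set// ger0_norm// EFinM.
    by rewrite /hA patchE memNset ?mule0.
  have mhA y : measurable_fun setT (hA y).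
    apply/(measurable_restrictT _ (mA y)).
    by apply: measurable_funTS; exact/measurable_EFinP.
  have hA0 y w : (0 <= hA y w)%E.
    by apply: erestrict_ge0 => *; rewrite lee_fin.
  rewrite ge0_integral_fsum//.
  - apply: eq_fsbigr => y _.
    by rewrite ge0_integralZl_EFin// -integral_mkcond.
  - by move=> y; exact: measurable_funeM.
  - by move=> y w _; rewrite mule_ge0// lee_fin.
rewrite !decomp//; apply: lee_fsum => // y _.
by rewrite lee_wpmul2l ?lee_fin//; exact: ab.
Qed.

(** [W] is the increasing limit of simple functions measurable for [<<s G>>], so monotone
    convergence on both sides carries the simple case to the limit. *)
Lemma le_integral_weighted d (Omega : measurableType d) (R : realType)
  (P : {measure set Omega -> \bar R}) (G : set_system Omega)
  (a b W : Omega -> R) :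
  G `<=` measurable ->
  measurable_fun setT a -> measurable_fun setT b ->
  (forall w, 0 <= a w) -> (forall w, 0 <= b w) ->
  (forall A, <<s G >> A ->
    (\int[P]_(w in A) (a w)%:E <= \int[P]_(w in A) (b w)%:E)%E) ->
  measurable_wrt G W -> (forall w, 0 <= W w) ->
  (\int[P]_w (W w * a w)%:E <= \int[P]_w (W w * b w)%:E)%E.
Proof.
move=> Gm ma mb a0 b0 ab mW W0.
have mEW : measurable_fun [set: g_sigma_algebraType G] (EFin \o W).
  exact/measurable_EFinP.
pose W_ := nnsfun_approx measurableT mEW.
have mW_ n : measurable_fun [set: Omega] (W_ n : Omega -> R).
  exact: (measurable_wrt_measurable Gm (measurable_funPT (W_ n))).
have cvgW (h : Omega -> R) : measurable_fun setT h -> (forall w, 0 <= h w) ->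
    (\int[P]_w (W_ n w * h w)%:E @[n --> \oo] --> \int[P]_w (W w * h w)%:E)%E.
  move=> mh h0.
  rewrite (_ : (fun w => (W w * h w)%:E) =
      (fun w => lim ((W_ n w * h w)%:E @[n --> \oo]))); last first.
    apply/funext => w; apply/esym/cvg_lim => //.
    under eq_fun do rewrite EFinM.
    rewrite EFinM; apply: cvgeZr => //.
    exact: (cvg_nnsfun_approx measurableT mEW (fun x _ => W0 x)).
  apply: (@cvg_monotone_convergence _ _ _ P setT measurableT
    (fun n w => (W_ n w * h w)%:E)).
  - by move=> n; apply/measurable_EFinP; exact: measurable_funM.
  - by move=> n w _; rewrite lee_fin mulr_ge0.
  - move=> w _ m n mn; rewrite lee_fin ler_wpM2r//.
    exact: (lefP _ _ (nd_nnsfun_approx measurableT mEW mn)).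
apply: (lee_cvg_to (cvgW a ma a0) (cvgW b mb b0)).
by apply: nearW => n; exact: le_integral_weighted_nnsfun.
Qed.

(** The version [g] may take negative values, so it is first replaced by its larger positive part.
    Since [0 <= eps], that part is still almost surely at most [eps], and comparison of nonnegative
    integrands applies. *)
Lemma cond_exp_le_integral d (Omega : measurableType d) (R : realType)
  (P : probability Omega R) (G : set_system Omega) (Z g : Omega -> R)
  (eps : R) (A : set Omega) :
  0 <= eps -> is_cond_exp P G Z g -> {ae P, forall w, g w <= eps} ->
  measurable A -> G A ->
  (\int[P]_(w in A) (Z w)%:E <= \int[P]_(w in A) eps%:E)%E.
Proof.
move=> eps0 [_ ig gZ] geps mA GA.
have mg : measurable_fun A (EFin \o g).
  by apply: measurable_funTS; exact: measurable_int ig.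
rewrite -gZ// integralE.
apply: (@le_trans _ _ (\int[P]_(w in A) ((EFin \o g)^\+ w))%E).
  by rewrite -[leRHS]sube0 leeB// integral_ge0// => *; exact: funeneg_ge0.
apply: ae_ge0_le_integral => //.
- exact: measurable_funepos.
- apply: filterS geps => w gw _.
  by rewrite funeposE ge_max; apply/andP; split; rewrite lee_fin.
Qed.

(** * The wealth process: nonnegativity, adaptedness and expectation *)

Lemma wealth0 (Omega : Type) (R : realType) (eps : R)
  (z lambda : nat -> Omega -> R) (w : Omega) : wealth eps z lambda 0 w = 1.
Proof. by rewrite /wealth big_geq. Qed.

Lemma wealthS (Omega : Type) (R : realType) (eps : R)
  (z lambda : nat -> Omega -> R) (t : nat) (w : Omega) :
  wealth eps z lambda t.+1 w =
  wealth eps z lambda t w * (1 + lambda t.+1 w * (z t.+1 w - eps)).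
(* Peeling off the last factor gives the recursion on which the inductions over time rest. *)
Proof. by rewrite /wealth big_nat_recr. Qed.

Lemma wealth_ge0 (Omega : Type) (R : realType) (eps : R)
  (z lambda : nat -> Omega -> R) (T : nat) :
  0 < eps ->
  (forall t w, horizon T t -> 0 <= z t w) ->
  (forall t w, horizon T t -> 0 <= lambda t w <= eps^-1) ->
  forall t w, (t <= T)%N -> 0 <= wealth eps z lambda t w.
Proof.
move=> eps0 z0 lb; elim=> [w _|t IH w tT]; first by rewrite wealth0.
have hT : horizon T t.+1 by [].
rewrite wealthS mulr_ge0 ?IH 1?ltnW//.
have /andP[l0 l1] := lb t.+1 w hT.
(* The new factor is [(1 - lambda * eps) + lambda * z], a sum of two nonnegative terms. *)
have : 0 <= lambda t.+1 w * z t.+1 w by rewrite mulr_ge0 ?z0.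
have : lambda t.+1 w * eps <= 1 by rewrite -ler_pdivlMr// div1r.
by rewrite mulrBr; lra.
Qed.

Lemma measurable_wrt_wealth d (Omega : measurableType d) (R : realType)
  (T : nat) (F : nat -> set_system Omega) (eps : R)
  (z lambda : nat -> Omega -> R) :
  (forall s t, (s <= t <= T)%N -> F s `<=` F t) ->
  (forall t, horizon T t -> measurable_wrt (F t) (z t)) ->
  predictable T F lambda ->
  forall t, (t <= T)%N -> measurable_wrt (F t) (wealth eps z lambda t).
Proof.
move=> Fmono mz ml t tT.
rewrite /measurable_wrt /wealth; apply: measurable_prod => i.
rewrite mem_index_iota ltnS => /andP[i1 it].
have hi : horizon T i by rewrite /horizon/= i1 (leq_trans it).
apply: measurable_funD; first exact: measurable_cst.
apply: measurable_funM.
  apply: measurable_wrtS (ml i hi); apply: Fmono.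
  by rewrite (leq_trans (leq_pred _)).
apply: measurable_funB; last exact: measurable_cst.
by apply: measurable_wrtS (mz i hi); apply: Fmono; rewrite it.
Qed.

Lemma expected_wealth_le1 d (Omega : measurableType d) (R : realType)
  (P : probability Omega R) (T : nat) (F : nat -> set_system Omega) (eps : R)
  (z lambda : nat -> Omega -> R) :
  0 < eps ->
  (forall t, sigma_algebra setT (F t)) ->
  (forall s t, (s <= t <= T)%N -> F s `<=` F t) ->
  (forall t, (t <= T)%N -> F t `<=` measurable) ->
  (forall t w, horizon T t -> 0 <= z t w) ->
  (forall t, horizon T t -> measurable_wrt (F t) (z t)) ->
  predictable T F lambda ->
  (forall t w, horizon T t -> 0 <= lambda t w <= eps^-1) ->
  null_hypothesis P T F z eps ->
  forall t, (t <= T)%N -> (\int[P]_w (wealth eps z lambda t w)%:E <= 1)%E.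
Proof.
move=> eps0 Fsigma Fmono Fm z0 mz ml lb hnull; elim=> [_|t IH tT].
  under eq_integral do rewrite wealth0.
  by rewrite integral_cst// mul1e probability_le1.
have {}IH := IH (ltnW tT).
have hT : horizon T t.+1 by [].
have [g cg geps] := hnull t.+1 hT.
have l0 w : 0 <= lambda t.+1 w by case/andP: (lb t.+1 w hT).
have l1 w : lambda t.+1 w * eps <= 1.
  by rewrite -ler_pdivlMr// div1r; case/andP: (lb t.+1 w hT).
pose S := wealth eps z lambda t; pose W w := S w * lambda t.+1 w.
have S0 w : 0 <= S w by apply: (wealth_ge0 eps0 z0 lb); exact: ltnW.
have S'0 w : 0 <= wealth eps z lambda t.+1 w by exact: (wealth_ge0 eps0 z0 lb).
have W0 w : 0 <= W w by rewrite mulr_ge0.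
have mSF u : (u <= T)%N -> measurable_wrt (F u) (wealth eps z lambda u).
  exact: measurable_wrt_wealth Fmono mz ml u.
have mWF : measurable_wrt (F t) W.
  by apply: measurable_funM; [exact: (mSF _ (ltnW tT))|exact: (ml _ hT)].
have mS : measurable_fun setT S.
  exact: measurable_wrt_measurable (Fm _ (ltnW tT)) (mSF _ (ltnW tT)).
have mS' : measurable_fun setT (wealth eps z lambda t.+1).
  exact: measurable_wrt_measurable (Fm _ tT) (mSF _ tT).
have mW : measurable_fun setT W.
  exact: measurable_wrt_measurable (Fm _ (ltnW tT)) mWF.
have mzt : measurable_fun setT (z t.+1).
  exact: measurable_wrt_measurable (Fm _ tT) (mz _ hT).
(* The null hypothesis enters here: it compares [z t.+1] with [eps] on each event of [F t], hence
   under the [F t]-measurable weight [W]. *)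
have Wz_le : (\int[P]_w (W w * z t.+1 w)%:E <= \int[P]_w (W w * eps)%:E)%E.
  apply: (le_integral_weighted (Fm _ (ltnW tT))) => //.
  - by move=> w; exact: z0.
  - by move=> w; exact: ltW.
  - move=> A FA; apply: (cond_exp_le_integral (ltW eps0) cg geps).
      exact: generated_sub_measurable (Fm _ (ltnW tT)) _ FA.
    (* The conditional expectation is tested on sets of [F t], the weights on sets of [<<s F t>>];
       the two families agree because [F t] is a sigma-algebra. *)
    by rewrite /= -(sigma_algebra_id (Fsigma t)).
(* Finiteness allows this term to be cancelled below. It holds because [lambda * eps <= 1] gives
   [W * eps <= S], and [S] has integral at most 1 by induction. *)
have Weps_fin : (\int[P]_w (W w * eps)%:E)%E \is a fin_num.
  rewrite ge0_fin_numE; last first.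
    by apply: integral_ge0 => w _; rewrite lee_fin mulr_ge0// ltW.
  apply: (@le_lt_trans _ _ 1%E); last exact: ltry.
  apply: le_trans IH; apply: ge0_le_integral => //.
  - by move=> w _; rewrite lee_fin mulr_ge0// ltW.
  - by apply/measurable_EFinP; exact: measurable_funM.
  - by apply/measurable_EFinP.
  - by move=> w _; rewrite lee_fin /W -mulrA ler_piMr.
(* With W = S lambda, the new wealth is S + W z - W eps; moving W eps to the
   left makes every integrand nonnegative. *)
rewrite -(leeD2rE _ _ Weps_fin).
have -> : (\int[P]_w (wealth eps z lambda t.+1 w)%:E
    + \int[P]_w (W w * eps)%:E
    = \int[P]_w (S w)%:E + \int[P]_w (W w * z t.+1 w)%:E)%E.
  rewrite -!ge0_integralD//.
  - apply: eq_integral => w _; rewrite -!EFinD wealthS; congr (_%:E).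
    by rewrite /W /S; ring.
  - by move=> w _; rewrite lee_fin.
  - exact/measurable_EFinP.
  - by move=> w _; rewrite lee_fin mulr_ge0// z0.
  - by apply/measurable_EFinP; exact: measurable_funM.
  - by move=> w _; rewrite lee_fin.
  - exact/measurable_EFinP.
  - by move=> w _; rewrite lee_fin mulr_ge0// ltW.
  - by apply/measurable_EFinP; exact: measurable_funM.
exact: leeD.
Qed.

(** * Stopping at the first crossing, and the maximal inequality *)

(** The product is the indicator that [M] stayed below [c] at all times strictly before [t].
    Excluding time [t] itself is what keeps the bet predictable. *)
Definition stopped_bet (Omega : Type) (R : realType) (c : R)
  (M lambda : nat -> Omega -> R) (t : nat) (w : Omega) : R :=
  lambda t w * \prod_(0 <= s < t) \1_[set v | M s v < c] w.

Lemma wealth_stopped_bet (Omega : Type) (R : realType) (eps c : R)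
  (z lambda : nat -> Omega -> R) (T t : nat) (w : Omega) :
  let M := wealth eps z lambda in
  (t <= T)%N -> c <= M t w ->
  c <= wealth eps z (stopped_bet c M lambda) T w.
Proof.
move=> M tT ct.
have exM : exists s, c <= M s w by exists t.
pose tau := ex_minn exM.
have [ctau tau_min] : c <= M tau w /\ (forall s, c <= M s w -> (tau <= s)%N).
  by rewrite /tau; case: ex_minnP.
have tauT : (tau <= T)%N by apply: leq_trans tT; exact: tau_min.
(* Up to the first crossing time [tau], every indicator in the bets placed equals 1, so both wealths
   agree. *)
have before s : (s <= tau)%N ->
    wealth eps z (stopped_bet c M lambda) s w = M s w.
  elim: s => [_|s IH stau]; first by rewrite /M !wealth0.
  rewrite /M !wealthS -/M IH 1?ltnW// /stopped_bet.
  rewrite [X in lambda _ _ * X]big_nat big1 ?mulr1// => r rs.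
  rewrite indicE mem_set//= ltNge; apply/negP => /tau_min.
  by rewrite leqNgt (leq_trans _ stau).
have after s : wealth eps z (stopped_bet c M lambda) (tau + s) w = M tau w.
  elim: s => [|s IH]; first by rewrite addn0 before.
  rewrite addnS wealthS IH /stopped_bet.
  (* From time [tau + 1] on, the product contains the factor of index [tau], which is 0: the bet
     vanishes and the wealth no longer moves. *)
  rewrite (bigD1_seq tau) ?iota_uniq ?mem_index_iota ?ltnS ?leq_addr//=.
  rewrite indicE memNset ?mul0r ?mulr0 ?mul0r ?addr0 ?mulr1//=.
  by apply/negP; rewrite -leNgt.
by rewrite -(subnKC tauT) after.
Qed.

(** The bet at time [t] looks at [M s] only for [s <= t.-1], and each such [M s] is measurable for
    [F s], hence for [F t.-1]. *)
Lemma predictable_stopped_bet d (Omega : measurableType d) (R : realType)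
  (T : nat) (F : nat -> set_system Omega) (c : R)
  (M lambda : nat -> Omega -> R) :
  (forall s t, (s <= t <= T)%N -> F s `<=` F t) ->
  (forall t, (t <= T)%N -> measurable_wrt (F t) (M t)) ->
  predictable T F lambda ->
  predictable T F (stopped_bet c M lambda).
Proof.
move=> Fmono mM ml t hT; have /andP[t1 tT] := hT.
apply: measurable_funM; first exact: ml.
apply: measurable_prod => s; rewrite mem_index_iota => /andP[_ st].
have st1 : (s <= t.-1)%N by rewrite -ltnS prednK.
have mMs : measurable_wrt (F t.-1) (M s).
  apply: measurable_wrtS (mM s (leq_trans (ltnW st) tT)); apply: Fmono.
  by rewrite st1 (leq_trans (leq_pred _)).
apply: measurable_indic.
rewrite (_ : [set v | _] = setT `&` M s @^-1` `]-oo, c[); last first.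
  by apply/seteqP; split=> v /=; rewrite in_itv//= => -[].
by apply: mMs => //; exact: measurable_itv.
Qed.

Lemma stopped_bet_bound (Omega : Type) (R : realType) (b c : R)
  (M lambda : nat -> Omega -> R) (t : nat) (w : Omega) :
  0 <= lambda t w <= b -> 0 <= stopped_bet c M lambda t w <= b.
Proof.
move=> /andP[l0 lb]; rewrite /stopped_bet.
have p0 : 0 <= \prod_(0 <= s < t) \1_[set v | M s v < c] w :> R.
  by apply: prodr_ge0 => s _; rewrite indicE ler0n.
have p1 : \prod_(0 <= s < t) \1_[set v | M s v < c] w <= 1 :> R.
  apply: prodr_ile1 => s _; rewrite indicE.
  by case: (_ \in _); rewrite ?lexx ler01.
by rewrite mulr_ge0//= (le_trans _ lb)// ler_piMr.
Qed.

Lemma ville_wealth d (Omega : measurableType d) (R : realType)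
  (P : probability Omega R) (T : nat) (F : nat -> set_system Omega)
  (eps c : R) (z lambda : nat -> Omega -> R) :
  0 < eps -> 0 < c ->
  (forall t, sigma_algebra setT (F t)) ->
  (forall s t, (s <= t <= T)%N -> F s `<=` F t) ->
  (forall t, (t <= T)%N -> F t `<=` measurable) ->
  (forall t w, horizon T t -> 0 <= z t w) ->
  (forall t, horizon T t -> measurable_wrt (F t) (z t)) ->
  predictable T F lambda ->
  (forall t w, horizon T t -> 0 <= lambda t w <= eps^-1) ->
  null_hypothesis P T F z eps ->
  (P [set w | exists2 t, (t <= T)%N & (c <= wealth eps z lambda t w)%R]
    <= c^-1%:E)%E.
Proof.
move=> eps0 c0 Fsigma Fmono Fm z0 mz ml lb hnull.
pose M := wealth eps z lambda; pose mu := stopped_bet c M lambda.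
have mM t : (t <= T)%N -> measurable_wrt (F t) (M t).
  exact: measurable_wrt_wealth Fmono mz ml t.
have mmu : predictable T F mu := predictable_stopped_bet c Fmono mM ml.
have mub t w : horizon T t -> 0 <= mu t w <= eps^-1.
  by move=> hT; apply: stopped_bet_bound; exact: lb.
pose S := wealth eps z mu T.
have mS : measurable_fun setT S.
  apply: (measurable_wrt_measurable (Fm T (leqnn T))).
  exact: measurable_wrt_wealth Fmono mz mmu T (leqnn T).
have level_measurable (h : Omega -> R) :
    measurable_fun setT h -> measurable [set w | c <= h w].
  move=> mh; rewrite (_ : [set w | _] = setT `&` h @^-1` `[c, +oo[).
    by apply: mh => //; exact: measurable_itv.
  by apply/seteqP; split=> w /=; rewrite in_itv/= andbT// => -[].
apply: (@le_trans _ _ (P [set w | c <= S w])).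
  apply: le_measure; rewrite ?inE; last first.
  - by move=> w [t tT]; exact: wealth_stopped_bet.
  - exact: level_measurable.
  (* The crossing event is measurable as a union of level events over the times 0 to [T]. *)
  rewrite (_ : [set w | _] = \bigcup_(t in `I_T.+1) [set w | c <= M t w]).
    apply: bigcup_measurable => t; rewrite /= ltnS => tT.
    apply: level_measurable.
    exact: measurable_wrt_measurable (Fm t tT) (mM t tT).
  by apply/seteqP; split=> w [t tT cM]; exists t.
rewrite -[leRHS]mule1 lee_pdivlMl//.
apply: le_trans
  (expected_wealth_le1 eps0 Fsigma Fmono Fm z0 mz mmu mub hnull (leqnn T)).
have mES : measurable_fun setT (EFin \o S) by exact/measurable_EFinP.
(* Markov's inequality for the absolute value of [S]; nonnegativity of the stopped wealth then
   removes the absolute values. *)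
have := le_integral_abse P measurableT mES c0.
under eq_integral => w _ do
  rewrite /= (ger0_norm (wealth_ge0 eps0 z0 mub w (leqnn T))).
rewrite setTI; congr (_ * P _ <= _)%E.
apply/funext => w.
by rewrite /= lee_fin (ger0_norm (wealth_ge0 eps0 z0 mub w _)).
Qed.

(** * The filtration generated by losses and guesses *)

Lemma history_sigma_algebra (Omega : Type) (R : realType)
  (z guess : nat -> Omega -> R) (t : nat) :
  sigma_algebra setT (history z guess t).
Proof. exact: smallest_sigma_algebra. Qed.

Lemma history_preimage (Omega : Type) (R : realType)
  (z guess : nat -> Omega -> R) (t i : nat) (B : set (R * R)) :
  (i < t)%N -> measurable B ->
  history z guess t ((fun w => (z i.+1 w, guess i.+1 w)) @^-1` B).
Proof.
move=> it mB; apply: sub_sigma_algebra; rewrite -bigcup_seq/=.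
exists (Ordinal it) => /=; first by rewrite mem_index_enum.
by exists B => //; rewrite setTI.
Qed.

Lemma history_sub (Omega : Type) (R : realType)
  (z guess : nat -> Omega -> R) (t : nat) (H : set_system Omega) :
  sigma_algebra setT H ->
  (forall i B, (i < t)%N -> measurable B ->
    H ((fun w => (z i.+1 w, guess i.+1 w)) @^-1` B)) ->
  history z guess t `<=` H.
Proof.
move=> sH preH; apply: smallest_sub => //; rewrite -bigcup_seq/=.
move=> A [i _ [B mB <-]]; rewrite setTI.
exact: (preH i B (ltn_ord i) mB).
Qed.

Lemma history_le (Omega : Type) (R : realType)
  (z guess : nat -> Omega -> R) (s t : nat) :
  (s <= t)%N -> history z guess s `<=` history z guess t.
Proof.
move=> st; apply: history_sub; first exact: history_sigma_algebra.
by move=> i B si mB; apply: history_preimage mB; exact: leq_trans si st.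
Qed.

Lemma measurable_wrt_history d (Omega : measurableType d) (R : realType)
  (z guess : nat -> Omega -> R) (t : nat) :
  measurable_wrt (history z guess t.+1) (z t.+1).
Proof.
move=> _ B mB; rewrite setTI; apply: sub_sigma_algebra.
(* The generators are preimages under pairs, so an event on the loss alone is written with a
   cylinder [B * setT]. *)
rewrite (_ : z t.+1 @^-1` B =
    (fun w => (z t.+1 w, guess t.+1 w)) @^-1` (B `*` setT)).
  by apply: history_preimage => //; exact: measurableX.
by apply/seteqP; split=> w //= -[].
Qed.

(** The induction alternates two facts: once the history up to [t] consists of measurable events,
    predictability makes the next guess measurable, and this makes the history up to [t.+1]
    measurable. *)
Lemma history_measurable d (Omega : measurableType d) (R : realType) (T : nat)
  (z guess : nat -> Omega -> R) :
  (forall t, horizon T t -> measurable_fun setT (z t)) ->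
  predictable T (history z guess) guess ->
  forall t, (t <= T)%N -> history z guess t `<=` measurable.
Proof.
move=> mz mguess; elim=> [_|t IH tT].
  by apply: history_sub => //; exact: sigma_algebra_measurable.
have hist_t := IH (ltnW tT).
apply: history_sub; first exact: sigma_algebra_measurable.
move=> i B; rewrite ltnS leq_eqVlt => /predU1P[->|it] mB; last first.
  by apply: hist_t; exact: history_preimage.
have hT : horizon T t.+1 by [].
have mzg := measurable_fun_pair (mz _ hT)
  (measurable_wrt_measurable hist_t (mguess _ hT)).
by rewrite -[_ @^-1` _]setTI; exact: mzg.
Qed.

Unset Implicit Arguments.
Set Strict Implicit.

Theorem lemma4p2 (R : realType)
  (d : measure_display) (Omega : measurableType d) (P : probability Omega R)
  (dX : measure_display) (X : measurableType dX)
  (dY : measure_display) (Y : measurableType dY) (D : Type)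
  (T : nat) (x : nat -> {RV P >-> X}) (y : nat -> {RV P >-> Y})
  (Psi : set R) (hPsi : Psi `<=` `[0, 1])
  (f : R -> X -> D)
  (loss : D -> Y -> R) (hloss : forall a b, 0 <= loss a b <= 1)
  (eps delta : R) (heps : 0 < eps < 1) (hdelta : 0 < delta < 1)
  (psi : R) (hpsi : Psi psi)
  (z : nat -> Omega -> R) (hz : z = loss_process loss f psi x y)
  (mz : forall t, horizon T t -> measurable_fun setT (z t))
  (guess : nat -> Omega -> R) (F : nat -> set_system Omega)
  (hF : F = history z guess) (hguess : predictable T F guess)
  (lambda : nat -> Omega -> R) (hlambda : predictable T F lambda)
  (lambda_bound : forall t w, horizon T t -> 0 <= lambda t w < eps^-1)
  (hnull : null_hypothesis P T F z eps) :
  (P [set w | exists2 t, horizon T t & (delta^-1 <= wealth eps z lambda t w)%R]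
    <= delta%:E)%E.
Proof.
have /andP[eps0 _] := heps; have /andP[delta0 delta1] := hdelta.
subst F; have mF := history_measurable mz hguess.
have z0 t w : horizon T t -> 0 <= z t w.
  move=> _; rewrite hz /loss_process.
  by case/andP: (hloss (f psi (x t w)) (y t w)).
have mzF t : horizon T t -> measurable_wrt (history z guess t) (z t).
  by case: t => // t _; exact: measurable_wrt_history.
have lb t w : horizon T t -> 0 <= lambda t w <= eps^-1.
  by move=> /(lambda_bound t w)/andP[-> /ltW].
have Fmono s t : (s <= t <= T)%N -> history z guess s `<=` history z guess t.
  by case/andP=> st _; exact: history_le.
have dV : 0 < delta^-1 by rewrite invr_gt0.
have := ville_wealth eps0 dV (history_sigma_algebra z guess) Fmono mF z0 mzF
  hlambda lb hnull.
(* The event bounded by [ville_wealth] also includes time 0, where the wealth is 1, below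
   [delta^-1]; no crossing occurs there, so the two events coincide. *)
rewrite invrK; congr (P _ <= _)%E.
apply/seteqP; split=> w [t hT Mt]; exists t => //; last by case/andP: hT.
rewrite /horizon/= hT andbT lt0n; apply/eqP => t0.
by move: Mt; rewrite t0 wealth0 leNgt invf_gt1// delta1.
Qed.
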